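(* Assume that (1) the chain with kernel $p$ has a unique stationary distribution $\mu$ and $\mu(U)>0$ for every non-empty (relatively) open $U\subseteq\mathcal S$; (2) $\sup_{s\in\mathcal S}\|x(s)\|<\infty$ and $\sup_{s\in\mathcal S}|r(s)|<\infty$; (3) for every measurable $f:\mathcal S\to\mathbb R^n$ with $f=0$ $\mu$-a.e., also $P_\pi f=0$ $\mu$-a.e. Then for any $w_0\in\mathbb R^d$ there exists $w_\infty(w_0)\in\mathcal W_*$ such that $$\lim_{t\to\infty}w(t;w_0)=w_\infty(w_0).$$
   Context: Setting: $K,d\in\mathbb N$; $\mathcal S\subseteq\mathbb R^K$ with its Borel $\sigma$-algebra; $p(\cdot\mid s)$ is a Markov transition kernel on $\mathcal S$; $r:\mathcal S\to\mathbb R$ is measurable; $\gamma\in[0,1)$; $x:\mathcal S\to\mathbb R^d$ is a measurable feature map (no linear independence is assumed). $(P_\pi f)(s)=\int_{\mathcal S}f(s')\,p(ds'\mid s)$. A stationary distribution is a probability measure $\mu$ with $\mu(Z)=\int_{\mathcal S}p(Z\mid s)\mu(ds)$ for all Borel $Z\subseteq\mathcal S$. $A=\int_{\mathcal S}x(s)\left(\gamma(P_\pi x)(s)^\top-x(s)^\top\right)\mu(ds)\in\mathbb R^{d\times d}$, $b=\int_{\mathcal S}x(s)r(s)\mu(ds)\in\mathbb R^d$, $\mathcal W_*=\{w\in\mathbb R^d: Aw+b=0\}$. $w(t;w_0)$ denotes the solution of the ODE $\frac{dw(t)}{dt}=Aw(t)+b$ with $w(0;w_0)=w_0$. *)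

(* Defs.v *)
From HB Require Import structures.
From mathcomp Require Import all_boot all_order all_algebra.
From mathcomp Require Import all_classical all_reals all_analysis.

Set Implicit Arguments.
Unset Strict Implicit.
Unset Printing Implicit Defensive.

Import Order.TTheory GRing.Theory Num.Theory.
Import numFieldNormedType.Exports.

Local Open Scope classical_set_scope.
Local Open Scope ring_scope.

Definition borel (T : ptopologicalType) := g_sigma_algebraType (@open T).

HB.instance Definition _ (T : ptopologicalType) := Measurable.on (borel T).

Definition borel_measurable (T U : ptopologicalType) (f : T -> U) : Prop :=
  measurable_fun [set: borel T] (f : borel T -> borel U).

(* The set S as a type with the subspace topology. Measurable types must be
   pointed in the library, hence the proof that S is inhabited; the chosen
   point plays no other role. *)
Definition subset_type (T : topologicalType) (S : set T) (S0 : S !=set0) : Type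
  := set_type S.

Section subset_type.
Variables (T : topologicalType) (S : set T) (S0 : S !=set0).

HB.instance Definition _ := Topological.copy (subset_type S0) (set_type S).

HB.instance Definition _ := isPointed.Build (subset_type S0)
  (exist _ (projT1 (cid S0)) (mem_set (projT2 (cid S0)))).

End subset_type.

Notation borel_subset S0 := (borel (subset_type S0)).

(* Entrywise integral; as for Rintegral, it is total, with a junk value at
   non-integrable entries. *)
Definition mxintegral d (T : measurableType d) (R : realType)
    (mu : {measure set T -> \bar R}) (m n : nat) (f : T -> 'M[R]_(m, n)) :
    'M[R]_(m, n) :=
  \matrix_(i, j) Rintegral mu [set: T] (fun s => f s i j).

Section markov_chain.
Context d (X : measurableType d) (R : realType).
Variable p : R.-pker X ~> X.

Definition markov_op (m n : nat) (f : X -> 'M[R]_(m, n)) (s : X) :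
  'M[R]_(m, n) := mxintegral (p s) f.

Definition stationary (mu : probability X R) : Prop :=
  forall Z : set X, measurable Z -> mu Z = (\int[mu]_s p s Z)%E.

(* Measures are functions on all sets, whose values at non-measurable sets are
   irrelevant, so uniqueness is up to equality on measurable sets. *)
Definition unique_stationary (mu : probability X R) : Prop :=
  stationary mu /\
  forall nu : probability X R, stationary nu ->
    forall Z : set X, measurable Z -> nu Z = mu Z.

End markov_chain.

Section temporal_difference.
Context dX (X : measurableType dX) (R : realType) (d : nat).
Variables (p : R.-pker X ~> X) (mu : probability X R) (gamma : R).
Variables (r : X -> R) (x : X -> 'cV[R]_d).

Definition td_matrix : 'M[R]_d :=
  mxintegral mu
    (fun s => x s *m (gamma *: (markov_op p x s)^T - (x s)^T)).

Definition td_vector : 'cV[R]_d := mxintegral mu (fun s => r s *: x s).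

Definition td_fixed_points : set 'cV[R]_d :=
  [set w | td_matrix *m w + td_vector = 0].

End temporal_difference.

(* Only the values of w on [0, +oo[ matter: at t = 0 the derivative is
   one-sided, and its existence and value there follow from continuity. *)
Definition affine_ode_solution (R : realType) (d : nat) (A : 'M[R]_d)
    (b w0 : 'cV[R]_d) (w : R -> 'cV[R]_d) : Prop :=
  [/\ w 0 = w0,
      {within `[0, +oo[, continuous w} &
      forall t : R, 0 < t -> is_derive t 1 w (A *m w t + b)].

(* Main.v *)
(** Let C be the integral of x x' with respect to mu (primes denote transposes).
    For f = y'x, Jensen's inequality and stationarity give |P f| <= |f| in
    L^2(mu), hence y'A y <= - (1 - gamma) y'C y. If y'C y = 0 then f = 0 in
    L^2(mu), so y'A = 0 and y'b = 0; since A is dissipative, A y = 0 as well.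
    Thus A vanishes on ker C, both b and im A lie in the orthogonal complement
    im C of ker C, and A is coercive on im C. Hence A w + b = 0 has a solution
    winf in w0 + im C, the error w - winf stays in im C, and its squared
    Euclidean norm decays exponentially. *)

Require Import Defs.
From HB Require Import structures.
From mathcomp Require Import all_boot all_order all_algebra.
From mathcomp Require Import all_classical all_reals all_analysis.
From mathcomp Require Import measurable_realfun ring lra.
Import Order.TTheory GRing.Theory Num.Theory.
Import numFieldNormedType.Exports.
Local Open Scope classical_set_scope.
Local Open Scope ring_scope.

(** * Dissipative matrices relative to a semidefinite form *)

(** The Euclidean inner product, read off a 1 x 1 matrix so that moving a matrix across it is
    associativity and transposition. The norm of ['cV[R]_n] is the max norm, so Euclidean lengths go
    through [dotmx u u]. *)
Definition dotmx {R : pzRingType} {n : nat} (u v : 'cV[R]_n) : R :=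
  (u^T *m v) 0 0.

Section dotmx.
Context {R : comPzRingType} {n : nat}.
Implicit Types (u v w : 'cV[R]_n) (a : R).

Lemma dotmxE u v : dotmx u v = \sum_i u i 0 * v i 0.
Proof. by rewrite /dotmx mxE; apply: eq_bigr => i _; rewrite mxE. Qed.

Lemma dotmxC u v : dotmx u v = dotmx v u.
Proof. by rewrite !dotmxE; apply: eq_bigr => i _; rewrite mulrC. Qed.

Lemma dotmxDl u v w : dotmx (u + v) w = dotmx u w + dotmx v w.
Proof. by rewrite /dotmx linearD mulmxDl mxE. Qed.

Lemma dotmxDr u v w : dotmx u (v + w) = dotmx u v + dotmx u w.
Proof. by rewrite /dotmx mulmxDr mxE. Qed.

Lemma dotmxZl a u v : dotmx (a *: u) v = a * dotmx u v.
Proof. by rewrite /dotmx linearZ/= -scalemxAl mxE. Qed.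

Lemma dotmxZr a u v : dotmx u (a *: v) = a * dotmx u v.
Proof. by rewrite /dotmx -scalemxAr mxE. Qed.

Lemma dotmx0l v : dotmx 0 v = 0.
Proof. by rewrite /dotmx trmx0 mul0mx mxE. Qed.

Lemma dotmx0r v : dotmx v 0 = 0.
Proof. by rewrite /dotmx mulmx0 mxE. Qed.

Lemma dotmx_mulr m (A : 'M[R]_(m, n)) (u : 'cV[R]_m) v :
  dotmx u (A *m v) = dotmx (A^T *m u) v.
Proof. by rewrite /dotmx trmx_mul trmxK mulmxA. Qed.

End dotmx.

Section dotmx_real.
Context {R : realDomainType} {n : nat}.
Implicit Types u v : 'cV[R]_n.

Lemma dotmx_ge0 u : 0 <= dotmx u u.
Proof. by rewrite dotmxE sumr_ge0// => i _; rewrite -expr2 sqr_ge0. Qed.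

Lemma sqr_coord_le_dotmx u i : u i 0 ^+ 2 <= dotmx u u.
Proof.
rewrite dotmxE (bigD1 i)//= expr2 lerDl sumr_ge0// => j _.
by rewrite -expr2 sqr_ge0.
Qed.

Lemma dotmx_eq0 u : dotmx u u = 0 -> u = 0.
Proof.
move=> u0; apply/colP => i; rewrite mxE; apply/eqP.
rewrite -sqrf_eq0 -(rwP eqP); apply: le_anti.
by rewrite sqr_ge0 -u0 sqr_coord_le_dotmx.
Qed.

Lemma dotmx_eq0P u : (forall v, dotmx v u = 0) -> u = 0.
Proof. by move=> /(_ u) /dotmx_eq0. Qed.

End dotmx_real.

Lemma linear_form_eq0 {R : realFieldType} (a b : R) :
  (forall s, 2 * s * a <= s ^+ 2 * b) -> a = 0.
Proof.
(* As c is positive and exceeds b, the hypothesis at s = a / c reads s^2 (2 c - b) <= 0 with 2 c - b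
   > 0, which forces s = 0. *)
move=> ab; pose c := `|b| + 1; have c0 : 0 < c by rewrite ltr_pwDr.
have bc : b < c by rewrite (le_lt_trans (ler_norm b))// ltrDl.
have ac0 : a / c * c = a by rewrite divfK// gt_eqF.
have := ab (a / c); rewrite -{2}ac0; move: (a / c) ac0 => s <- abs.
suff -> : s = 0 by rewrite mul0r.
apply/eqP; rewrite -sqrf_eq0 -(rwP eqP); apply: le_anti; rewrite sqr_ge0 andbT.
have : s ^+ 2 * (2 * c - b) <= 0 by nra.
by rewrite pmulr_lle0//; lra.
Qed.

(** The squared length of B u is the quadratic form of B'B at u, and each product u_i u_j is at most
    u'u in absolute value. The 1 added to the constant makes it positive. *)
Lemma dotmx_mulmx_bounded {R : realFieldType} {m n : nat} (B : 'M[R]_(m, n)) :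
  exists2 K, 0 < K &
    forall u : 'cV[R]_n, dotmx (B *m u) (B *m u) <= K * dotmx u u.
Proof.
pose M := B^T *m B; pose K := \sum_i \sum_j `|M i j|.
have K0 : 0 <= K by apply: sumr_ge0 => i _; apply: sumr_ge0.
exists (1 + K) => [|u]; first by rewrite ltr_pwDl.
have uu i j : `|u i 0 * u j 0| <= dotmx u u.
  have := sqr_coord_le_dotmx u i; have := sqr_coord_le_dotmx u j.
  rewrite -[u i 0 ^+ 2]real_normK ?num_real//.
  rewrite -[u j 0 ^+ 2]real_normK ?num_real//.
  rewrite normrM; have := sqr_ge0 (`|u i 0| - `|u j 0|).
  by move: `|u i 0| `|u j 0| (dotmx u u) => a b c; lra.
rewrite dotmx_mulr mulmxA -/M dotmxC dotmxE mulrDl mul1r.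
apply: ler_wpDl; first exact: dotmx_ge0.
rewrite mulr_suml; apply: ler_sum => i _; rewrite mxE mulr_sumr mulr_suml.
apply: ler_sum => j _; rewrite mulrCA (le_trans (ler_norm _))// normrM.
by rewrite ler_wpM2l.
Qed.

Section dissipative.
Context {R : realFieldType} {d : nat}.
Context {A C : 'M[R]_d} {b : 'cV[R]_d} {g : R}.
Hypotheses (g_gt0 : 0 < g) (C_sym : C^T = C).
Hypothesis C_psd : forall y, 0 <= dotmx y (C *m y).
Hypothesis A_dissipative : forall y, dotmx y (A *m y) <= - g * dotmx y (C *m y).
Hypothesis C_null :
  forall y, dotmx y (C *m y) = 0 -> A^T *m y = 0 /\ dotmx y b = 0.

(* Testing dissipativity on y + 2 s v for all s kills the term linear in s. *)
Lemma dissipative_ker_sub (y : 'cV[R]_d) : C *m y = 0 -> A *m y = 0.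
Proof.
move=> Cy0; have yCy0 : dotmx y (C *m y) = 0 by rewrite Cy0 dotmx0r.
have [yA0 _] := C_null y yCy0.
apply: dotmx_eq0P => v.
(* Since y'A = 0, the form of A at y + 2 s v reduces to 2 s v'A y + 4 s^2 v'A v, which is
   nonpositive. *)
apply: (@linear_form_eq0 _ _ (- (4 * dotmx v (A *m v)))) => s.
have := A_dissipative (y + (2 * s) *: v).
have := mulr_ge0 (ltW g_gt0) (C_psd (y + (2 * s) *: v)).
rewrite !mulmxDr -!scalemxAr !(dotmxDl, dotmxDr, dotmxZl, dotmxZr).
rewrite [dotmx y (A *m y)]dotmx_mulr [dotmx y (A *m v)]dotmx_mulr yA0 mulNr.
rewrite !dotmx0l.
move: (g * _) (dotmx v _) (dotmx v _) => a e f; lra.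
Qed.

(** A generalized inverse of C gives a preimage v of y = C z whose length is controlled by that of
    y. Nonnegativity of C at K y - v then yields the bound. *)
Lemma psd_coercive : exists2 K, 0 < K &
  forall z : 'cV[R]_d,
    dotmx (C *m z) (C *m z) <= K * dotmx (C *m z) (C *m (C *m z)).
Proof.
pose D := pinvmx C; have CDC : C *m D *m C = C by rewrite mulmxKpV.
have [L L0 LP] := dotmx_mulmx_bounded D; have L1 : 0 < L + 1 by lra.
exists (L + 1) => // z.
set y := C *m z; set v := D *m y.
have Cv : C *m v = y by rewrite /v /y -[in RHS]CDC -!mulmxA.
have vyC : dotmx v (C *m y) = dotmx y y by rewrite dotmx_mulr C_sym Cv.
have vy : dotmx v y <= (L + 1) * dotmx y y.
  have := dotmx_ge0 (v - y); have := LP y; rewrite -/v.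
  rewrite -scaleN1r !(dotmxDl, dotmxDr, dotmxZl, dotmxZr) [dotmx y v]dotmxC.
  have := dotmx_ge0 y; have := mulr_ge0 (ltW L0) (dotmx_ge0 y).
  by move: (dotmx v v) (dotmx v y) (dotmx y y) => p q r; lra.
(* With K = L + 1 the form here is K^2 y'C y - 2 K y'y + v'y; inserting v'y <= K y'y and dividing by
   K leaves y'y <= K y'C y. *)
have := C_psd ((L + 1) *: y - v).
rewrite -scaleN1r mulmxDr -!scalemxAr Cv.
rewrite !(dotmxDl, dotmxDr, dotmxZl, dotmxZr) vyC.
move: (L + 1) (dotmx y (C *m y)) (dotmx v y) (dotmx y y) L1 vy.
move=> K p q r K0 qKr.
by move=> yv; rewrite -(ler_pM2l K0); lra.
Qed.

(** Fredholm alternative: the residual e lies in im (A C) once it is orthogonal to every y with (A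
    C)'y = 0. For such y, C A'y = 0 gives A A'y = 0, hence A'y = 0; dissipativity gives y'C y = 0,
    and [C_null] gives y'b = 0. *)
Lemma dissipative_solvable (w : 'cV[R]_d) :
  exists z : 'cV[R]_d, A *m (w + C *m z) + b = 0.
Proof.
pose e := - (A *m w + b).
suff /submxP[z ez] : (e^T <= (A *m C)^T)%MS.
  exists z^T; rewrite mulmxDr mulmxA addrAC.
  have -> : A *m C *m z^T = e by apply: trmx_inj; rewrite ez trmx_mul trmxK.
  by rewrite addrN.
rewrite submxE; apply/eqP/matrixP => i j; rewrite [RHS]mxE.
(* The columns of this cokernel span the vectors y with (A C)'y = 0. *)
pose y := col j (cokermx (A *m C)^T).
have ACy : C *m (A^T *m y) = 0.
  by rewrite -{1}C_sym mulmxA -trmx_mul /y colE mulmxA mulmx_coker mul0mx.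
have Ay0 : A^T *m y = 0.
  by apply: dotmx_eq0; rewrite -dotmx_mulr (dissipative_ker_sub _ ACy) dotmx0r.
have yAy : dotmx y (A *m y) = 0 by rewrite dotmx_mulr Ay0 dotmx0l.
have yCy : dotmx y (C *m y) = 0.
  apply: le_anti; rewrite C_psd andbT -(pmulr_rle0 _ g_gt0).
  by have := A_dissipative y; rewrite yAy mulNr oppr_ge0.
have [_ yb] := C_null y yCy.
have ye : dotmx e y = 0.
  rewrite dotmxC /e -scaleN1r dotmxZr dotmxDr yb dotmx_mulr Ay0.
  by rewrite dotmx0l addr0 mulr0.
rewrite (ord1 i) -[RHS]ye /dotmx [LHS]mxE [RHS]mxE.
by apply: eq_bigr => k _; rewrite /y [X in _ = _ * X]mxE.
Qed.

(** Q A = 0 makes Q u constant along u' = A u, so with the other two properties a solution starting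
    in im C never leaves it. *)
Lemma dissipative_invariant_projector : exists Q : 'M[R]_d,
  [/\ Q *m C = 0, Q *m A = 0 &
      forall y : 'cV[R]_d, Q *m y = 0 -> exists z, y = C *m z].
Proof.
pose Q := 1%:M - C *m pinvmx C.
have QC : Q *m C = 0 by rewrite mulmxBl mul1mx mulmxKpV// subrr.
exists Q; split=> // [|y /eqP].
  apply: trmx_inj; rewrite trmx0 trmx_mul; apply/matrixP => i j.
  (* A row q' of Q satisfies q'C = 0, so C q = 0 by symmetry, and [C_null] turns this into q'A =
     0. *)
  pose q := col j Q^T.
  have Cq : C *m q = 0.
    by rewrite /q colE mulmxA -C_sym -trmx_mul QC trmx0 mul0mx.
  have [+ _] := C_null q ltac:(by rewrite Cq dotmx0r).
  rewrite /q colE mulmxA -colE => /colP/(_ i).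
  by rewrite [LHS]mxE => ->; rewrite !mxE.
by rewrite mulmxBl mul1mx subr_eq0 -mulmxA => /eqP; exists (pinvmx C *m y).
Qed.

End dissipative.

(** * Exponential decay along an affine differential equation *)

Lemma is_derive_coord {R : realFieldType} {V : normedModType R} {m n : nat}
    {M : V -> 'M[R]_(m, n)} {t v : V} {dM : 'M[R]_(m, n)}
    (i : 'I_m) (j : 'I_n) :
  is_derive t v M dM -> is_derive t v (fun x => M x i j) (dM i j).
Proof.
move=> dMt; have dM1 := @ex_derive _ _ _ _ _ _ _ dMt.
apply: DeriveDef; first exact: (derivable_mxP M t v).1.
by rewrite -(@derive_val _ _ _ _ _ _ _ dMt) derive_mx// mxE.
Qed.

Lemma is_derive_mulmx_coord {R : realFieldType} {V : normedModType R}
    {m n p : nat}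
    {M : V -> 'M[R]_(n, p)} {t v : V} {dM : 'M[R]_(n, p)} (P : 'M[R]_(m, n))
    (i : 'I_m) (j : 'I_p) :
  is_derive t v M dM ->
  is_derive t v (fun x => (P *m M x) i j) ((P *m dM) i j).
Proof.
move=> dMt; rewrite mxE.
have -> : (fun x => (P *m M x) i j) = \sum_k (P i k \*: (fun x => M x k j)).
  by apply/funext => x; rewrite fct_sumE mxE.
by apply: is_derive_sum => k; apply: is_deriveZ; exact: is_derive_coord.
Qed.

Lemma continuous_mulmx_coord {K : numFieldType} {m n p : nat} (P : 'M[K]_(m, n))
    (i : 'I_m) (j : 'I_p) :
  continuous (fun M : 'M[K]_(n, p) => (P *m M) i j).
Proof.
under eq_fun do rewrite mxE.
refine (@continuous_big K _ +%R 0 xpredT (@add_continuous K) _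
  (index_enum 'I_n) (fun k (M : 'M[K]_(n, p)) => P i k * M k j) _).
move=> k _ M; apply: (@continuousM _ _ (cst (P i k))
  (fun M : 'M[K]_(n, p) => M k j)).
  exact: cst_continuous.
exact: coord_continuous.
Qed.

(** Grönwall's argument: the product of exp (2 k t) and the sum of squares has nonpositive
    derivative for t > 0, and continuity at 0 brings the initial value into the comparison. The sign
    of k is free. *)
Lemma sum_sqr_decay {R : realType} {n : nat} (y g : 'I_n -> R -> R) (k : R) :
  (forall i, {within `[0, +oo[, continuous (y i)}) ->
  (forall t : R, 0 < t -> forall i, is_derive t 1 (y i) (g i t)) ->
  (forall t : R, 0 < t -> \sum_i y i t * g i t <= - k * \sum_i y i t ^+ 2) ->
  forall t : R, 0 <= t ->
    \sum_i y i t ^+ 2 <= expR (- (2 * k * t)) * \sum_i y i 0 ^+ 2.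
Proof.
move=> yc dy yg t t0.
pose V := (fun t => \sum_i y i t ^+ 2); pose e := (fun t => expR (2 * k * t)).
have de (s : R) : is_derive s 1 e (2 * k * e s).
  rewrite mulrC; apply: (@is_derive1_comp _ expR (fun t => 2 * k * t)).
  apply: is_derive_eq. exact: mulr1.
have dV (s : R) : 0 < s -> is_derive s 1 V (\sum_i 2 * (y i s * g i s)).
  move=> s0; rewrite /V.
  have -> : (fun t => \sum_i y i t ^+ 2) = \sum_i (y i) ^+ 2.
    by apply/funext => u; rewrite fct_sumE.
  apply: is_derive_sum => i; have dyi := dy s s0 i.
  by apply: is_derive_eq; rewrite expr1 mulrA.
have deV (s : R) : 0 < s ->
    is_derive s 1 (e * V)
      (e s * (\sum_i 2 * (y i s * g i s)) + V s * (2 * k * e s)).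
  by move=> s0; have dVs := dV s s0; have des := de s; apply: is_derive_eq.
have : (e * V) t <= (e * V) 0.
  apply: (@ler0_derive1_nincry _ _ 0) => // [s|s|].
  - by rewrite in_itv/= andbT => s0; have [] := deV s s0.
  - rewrite in_itv/= andbT => s0; rewrite derive1E.
    rewrite (@derive_val _ _ _ _ _ _ _ (deV s s0)).
    rewrite -mulr_sumr; have := yg s s0; rewrite -/(V s).
    rewrite (_ : _ + _ = 2 * e s * (\sum_i y i s * g i s + k * V s)); last ring.
    move=> H; rewrite pmulr_rle0; last by rewrite mulr_gt0// expR_gt0.
    by move: H; rewrite /V; lra.
  - move=> s; apply: continuousM.
      apply: continuous_subspaceT => u; apply: differentiable_continuous.
      by apply/derivable1_diffP; have [] := de u.
    move: s; refine (@continuous_big R _ +%R 0 xpredT (@add_continuous R) _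
      (index_enum 'I_n) (fun i => from_subspace _ (fun t => y i t ^+ 2)) _).
    move=> i _ u.
    exact: (@continuous_comp _ _ _ (from_subspace _ (y i)) (fun r => r ^+ 2) u
      (yc i u) (@exprn_continuous _ 2 _)).
have e0 : e 0 = 1 by rewrite /e mulr0 expR0.
change (e t * V t <= e 0 * V 0 -> V t <= expR (- (2 * k * t)) * V 0).
rewrite e0 mul1r => eV.
by rewrite expRN mulrC ler_pdivlMr ?expR_gt0// mulrC.
Qed.

Lemma affine_ode_cvg {R : realType} {d : nat} (A C : 'M[R]_d) (b : 'cV[R]_d)
    (g : R) :
  0 < g -> C^T = C ->
  (forall y : 'cV[R]_d, 0 <= dotmx y (C *m y)) ->
  (forall y : 'cV[R]_d, dotmx y (A *m y) <= - g * dotmx y (C *m y)) ->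
  (forall y : 'cV[R]_d,
     dotmx y (C *m y) = 0 -> A^T *m y = 0 /\ dotmx y b = 0) ->
  forall w0 : 'cV[R]_d, exists2 winf : 'cV[R]_d, A *m winf + b = 0 &
    forall w : R -> 'cV[R]_d, affine_ode_solution A b w0 w ->
      w t @[t --> +oo] --> winf.
Proof.
move=> g0 C_sym C_psd A_diss C_null w0.
have [z Az] := dissipative_solvable g0 C_sym C_psd A_diss C_null w0.
have [K K0 KP] := psd_coercive C_sym C_psd.
have [Q [QC QA QP]] := dissipative_invariant_projector C_sym C_null.
set winf := w0 + C *m z in Az *; exists winf => // w [w_0 wc dw].
pose u t := w t - winf.
have Au t : A *m u t = A *m w t + b by rewrite mulmxBr (addr0_eq Az).
have uc (P : 'M[R]_d) i :
    {within `[0, +oo[, continuous (fun t => (P *m u t) i 0)}.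
  have -> : (fun t => (P *m u t) i 0) =
      (fun M : 'cV[R]_d => (P *m M) i 0) \o w \- cst ((P *m winf) i 0).
    by apply/funext => t; rewrite /= mulmxBr mxE [X in _ + X]mxE.
  move=> t; apply: continuousB; last exact: cst_continuous.
  exact: (@continuous_comp _ _ _ (from_subspace _ w)
    (fun M : 'cV[R]_d => (P *m M) i 0) t (wc t)
    (@continuous_mulmx_coord _ _ _ _ P i 0 _)).
have du (P : 'M[R]_d) (t : R) : 0 < t -> forall i,
    is_derive t 1 (fun t => (P *m u t) i 0) ((P *m (A *m u t)) i 0).
  move=> t0 i; apply: is_derive_mulmx_coord; rewrite Au.
  have dwt := dw t t0; rewrite /u -[A *m w t + b]subr0.
  exact: (@is_deriveB _ _ _ w (cst winf)).
(* A general P lets the same estimate serve for [Q] and for the identity. *)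
have decay (P : 'M[R]_d) (k : R) :
    (forall t, 0 < t -> dotmx (P *m u t) (P *m (A *m u t)) <=
                        - k * dotmx (P *m u t) (P *m u t)) ->
    forall t, 0 <= t -> dotmx (P *m u t) (P *m u t) <=
      expR (- (2 * k * t)) * dotmx (P *m u 0) (P *m u 0).
  move=> Pk t t0.
  have dotmx_sqr (v : 'cV[R]_d) : dotmx v v = \sum_i v i 0 ^+ 2.
    by rewrite dotmxE; under eq_bigr do rewrite -expr2.
  rewrite !dotmx_sqr; apply: (@sum_sqr_decay _ _ (fun i t => (P *m u t) i 0)
    (fun i t => (P *m (A *m u t)) i 0)) => // s s0.
  by rewrite -dotmx_sqr -dotmxE; exact: Pk.
(* Q A = 0, so Q u is constant: decay with rate 0. *)
have Qu t : 0 <= t -> Q *m u t = 0.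
  move=> t0; apply: dotmx_eq0; apply: le_anti; rewrite dotmx_ge0 andbT.
  (* The initial error is - C z, which Q annihilates. *)
  have Qu0 : Q *m u 0 = 0.
    by rewrite /u w_0 /winf opprD addNKr mulmxN mulmxA QC mul0mx oppr0.
  have := decay Q 0 _ t t0; rewrite Qu0 dotmx0l mulr0; apply => s s0.
  by rewrite mulmxA QA mul0mx dotmx0r oppr0 mul0r.
(* On im C, coercivity turns the dissipation - g u'C u into at most - (g / K) u'u. *)
pose k := g / K; have k0 : 0 < k by rewrite divr_gt0.
pose N := dotmx (u 0) (u 0).
have u_decay t : 0 <= t -> dotmx (u t) (u t) <= expR (- (2 * k * t)) * N.
  move=> t0; rewrite -(mul1mx (u t)) /N -(mul1mx (u 0)).
  apply: decay => // s s0.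
  rewrite !mul1mx (le_trans (A_diss _))// !mulNr lerN2 /k -mulrA ler_pM2l//.
  have [v ->] := QP (u s) (Qu s (ltW s0)).
  by rewrite mulrC ler_pdivrMr// mulrC.
apply/cvgrPdist_le => /= e e0; near=> t.
have t0 : 0 <= t by near: t; exact: nbhs_pinfty_ge.
(* From such times on, exp (2 k t) >= 2 k t gives N exp (- 2 k t) <= e^2. *)
have Nt : N <= e ^+ 2 * (2 * k * t).
  rewrite mulrA -ler_pdivrMl; last first.
    by apply: mulr_gt0; [exact: exprn_gt0|exact: mulr_gt0].
  by near: t; apply: nbhs_pinfty_ge; rewrite num_real.
rewrite /Num.Def.normr/= mx_normrE (bigmax_le _ (ltW e0))//= => -[i j] _ /=.
rewrite (ord1 j) -(@ler_pXn2r _ 2)// ?nnegrE// ?(ltW e0)//.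
rewrite real_normK ?num_real// -sqrrN (_ : - _ = u t i 0); last first.
  by rewrite /u !mxE opprB.
apply: le_trans (sqr_coord_le_dotmx (u t) i) _.
apply: le_trans (u_decay t t0) _.
rewrite expRN mulrC ler_pdivrMr ?expR_gt0// (le_trans Nt)//.
rewrite ler_pM2l ?exprn_gt0//.
by rewrite (le_trans _ (expR_ge1Dx _))// lerDr.
Unshelve. all: by end_near. Qed.

(** * Integrals of bounded measurable functions *)

(** The bound is pointwise and mentions no measure, so one predicate gives integrability against
    [mu] and against every [p s]. *)
Definition bounded_measurable {d : measure_display} {T : measurableType d}
    {R : realType} (f : T -> R) : Prop :=
  measurable_fun [set: T] f /\ exists M : R, forall s, `|f s| <= M.

Section bounded_measurable.
Context {d : measure_display} {T : measurableType d} {R : realType}.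
Implicit Types f g : T -> R.

Lemma bounded_measurable_cst (c : R) : bounded_measurable (fun _ : T => c).
Proof. by split; [exact: measurable_cst|exists `|c|]. Qed.

Lemma bounded_measurableD f g : bounded_measurable f -> bounded_measurable g ->
  bounded_measurable (fun s => f s + g s).
Proof.
move=> [mf [M fM]] [mg [N gN]]; split; first exact: measurable_funD.
by exists (M + N) => s; rewrite (le_trans (ler_normD _ _))// lerD.
Qed.

Lemma bounded_measurableM f g : bounded_measurable f -> bounded_measurable g ->
  bounded_measurable (fun s => f s * g s).
Proof.
move=> [mf [M fM]] [mg [N gN]]; split; first exact: measurable_funM.
by exists (M * N) => s; rewrite normrM ler_pM.
Qed.

Lemma bounded_measurableZ (c : R) f : bounded_measurable f ->
  bounded_measurable (fun s => c * f s).
Proof. by apply: bounded_measurableM; exact: bounded_measurable_cst. Qed.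

Lemma bounded_measurableB f g : bounded_measurable f -> bounded_measurable g ->
  bounded_measurable (fun s => f s - g s).
Proof.
move=> bf bg; under eq_fun do rewrite -mulN1r.
exact/bounded_measurableD/bounded_measurableZ.
Qed.

Lemma bounded_measurable_sum (n : nat) (f : 'I_n -> T -> R) :
  (forall i, bounded_measurable (f i)) ->
  bounded_measurable (fun s => \sum_i f i s).
Proof.
move=> bf; have -> : (fun s => \sum_i f i s) = \sum_i f i.
  by apply/funext => s; rewrite fct_sumE.
elim/big_ind : _ => [|g h|i _]; last exact: bf.
- exact: bounded_measurable_cst.
- exact: bounded_measurableD.
Qed.

Lemma bounded_measurable_dotmx (n : nat) (x : T -> 'cV[R]_n) (y : 'cV[R]_n) :
  (forall i, bounded_measurable (fun s => x s i 0)) ->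
  bounded_measurable (fun s => dotmx y (x s)).
Proof.
move=> bx; under eq_fun do rewrite dotmxE.
by apply: bounded_measurable_sum => i; exact: bounded_measurableZ.
Qed.

End bounded_measurable.

Section probability_integral.
Context {d : measure_display} {T : measurableType d} {R : realType}.
(** A measure of mass one, so that the results apply to [mu] and to each [p s] alike. *)
Variables (P : {measure set T -> \bar R}) (P1 : P [set: T] = 1%E).
Implicit Types f g : T -> R.

Lemma bounded_measurable_integrable f : bounded_measurable f ->
  P.-integrable [set: T] (EFin \o f).
Proof.
move=> [mf [M fM]]; apply: measurable_bounded_integrable => //.
  by rewrite P1 ltry.
exists M; split; first exact: num_real.
by move=> N MN s _ /=; rewrite (le_trans (fM s))// ltW.
Qed.

Lemma RintegralZ (c : R) f : bounded_measurable f ->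
  Rintegral P [set: T] (fun s => c * f s) = c * Rintegral P [set: T] f.
Proof.
by move=> bf; rewrite RintegralZl//; exact: bounded_measurable_integrable.
Qed.

Lemma Rintegral_add f g : bounded_measurable f -> bounded_measurable g ->
  Rintegral P [set: T] (fun s => f s + g s) =
  Rintegral P [set: T] f + Rintegral P [set: T] g.
Proof.
by move=> bf bg; rewrite RintegralD//; exact: bounded_measurable_integrable.
Qed.

Lemma Rintegral_sum (n : nat) (f : 'I_n -> T -> R) :
  (forall i, bounded_measurable (f i)) ->
  Rintegral P [set: T] (fun s => \sum_i f i s) =
  \sum_i Rintegral P [set: T] (f i).
Proof.
elim: n f => [f _|n IH f bf].
  rewrite big_ord0 (_ : (fun s => _) = fun=> 0).
    by rewrite Rintegral_cst// mul0r.
  by apply/funext => s; rewrite big_ord0.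
rewrite big_ord_recl -IH// -Rintegral_add//; last exact: bounded_measurable_sum.
by congr (Rintegral _ _ _); apply/funext => s; rewrite big_ord_recl.
Qed.

Lemma Rintegral_probability_cst (c : R) :
  Rintegral P [set: T] (fun=> c) = c.
Proof.
by rewrite Rintegral_cst// P1 mulr1. Qed.

Lemma Rintegral_le f g : bounded_measurable f -> bounded_measurable g ->
  (forall s, f s <= g s) ->
  Rintegral P [set: T] f <= Rintegral P [set: T] g.
Proof.
by move=> bf bg fg; apply: le_Rintegral => //;
  exact: bounded_measurable_integrable.
Qed.

(** The variance, the integral of (f - c)^2 with c the mean of f, is nonnegative. *)
Lemma sqr_Rintegral_le f : bounded_measurable f ->
  Rintegral P [set: T] f ^+ 2 <= Rintegral P [set: T] (fun s => f s * f s).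
Proof.
move=> bf; set c := Rintegral _ _ _; rewrite -subr_ge0.
have : 0 <= Rintegral P [set: T] (fun s => (f s - c) * (f s - c)).
  by apply: Rintegral_ge0 => s _; rewrite -expr2 sqr_ge0.
have -> : (fun s => (f s - c) * (f s - c)) =
    (fun s => f s * f s + (- (2 * c) * f s + c ^+ 2)).
  by apply/funext => s; ring.
have bff := bounded_measurableM _ _ bf bf.
have bcf := bounded_measurableZ (- (2 * c)) _ bf.
rewrite Rintegral_add//; last first.
  exact/bounded_measurableD/bounded_measurable_cst.
rewrite Rintegral_add//; last exact: bounded_measurable_cst.
rewrite RintegralZ// Rintegral_probability_cst -/c.
by congr (0 <= _); ring.
Qed.

(** The integral of (f - c g)^2 is nonnegative for every c; as its f^2 term vanishes, the term
    linear in c must vanish too. *)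
Lemma Rintegral_mul_eq0 f g : bounded_measurable f -> bounded_measurable g ->
  Rintegral P [set: T] (fun s => f s * f s) = 0 ->
  Rintegral P [set: T] (fun s => f s * g s) = 0.
Proof.
move=> bf bg f0.
apply: (@linear_form_eq0 _ _ (Rintegral P [set: T] (fun s => g s * g s))) => c.
have : 0 <= Rintegral P [set: T] (fun s => (f s - c * g s) * (f s - c * g s)).
  by apply: Rintegral_ge0 => s _; rewrite -expr2 sqr_ge0.
have -> : (fun s => (f s - c * g s) * (f s - c * g s)) =
    (fun s => f s * f s + (- (2 * c) * (f s * g s) + c ^+ 2 * (g s * g s))).
  by apply/funext => s; ring.
have bff := bounded_measurableM _ _ bf bf.
have bfg := bounded_measurableM _ _ bf bg.
have bgg := bounded_measurableM _ _ bg bg.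
rewrite Rintegral_add//; last first.
  by apply: bounded_measurableD; exact: bounded_measurableZ.
rewrite Rintegral_add//; [|exact: bounded_measurableZ..].
by rewrite !RintegralZ// f0; lra.
Qed.

(** Reduces statements on integrated matrices to scalar integrals. *)
Lemma dotmx_mxintegral (m n : nat) (F : T -> 'M[R]_(m, n)) (u : 'cV[R]_m)
    (v : 'cV[R]_n) :
  (forall i j, bounded_measurable (fun s => F s i j)) ->
  dotmx u (mxintegral P F *m v) =
  Rintegral P [set: T] (fun s => dotmx u (F s *m v)).
Proof.
move=> bF.
have bFv i : bounded_measurable (fun s => \sum_j v j 0 * F s i j).
  by apply: bounded_measurable_sum => j; exact: bounded_measurableZ.
rewrite dotmxE.
have -> : (fun s => dotmx u (F s *m v)) =
    (fun s => \sum_i u i 0 * \sum_j v j 0 * F s i j).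
  apply/funext => s; rewrite dotmxE; apply: eq_bigr => i _; rewrite mxE.
  by under [in LHS]eq_bigr do rewrite mulrC.
rewrite Rintegral_sum => [|i]; last exact: bounded_measurableZ.
apply: eq_bigr => i _; rewrite RintegralZ// Rintegral_sum => [|j]; last first.
  exact: bounded_measurableZ.
rewrite mxE; congr (_ * _); apply: eq_bigr => j _.
by rewrite RintegralZ// mxE mulrC.
Qed.

End probability_integral.

(** * Averages against the transition kernel and stationarity *)

Section kernel_average.
Context {d : measure_display} {X : measurableType d} {R : realType}.
Variable p : R.-pker X ~> X.

Lemma bounded_measurable_average (f : X -> R) : bounded_measurable f ->
  bounded_measurable (fun s => Rintegral (p s) [set: X] f).
Proof.
move=> bf; have [mf [M fM]] := bf.
have p1 s : p s [set: X] = 1%E by exact: prob_kernel.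
split; last first.
  exists M => s; rewrite ler_norml.
  apply/andP; split.
    rewrite -[leLHS](Rintegral_probability_cst (p s) (p1 s)).
    apply: (Rintegral_le _ (p1 s)) => // [|t].
      exact: bounded_measurable_cst.
    by have := fM t; rewrite ler_norml => /andP[].
  rewrite -[leRHS](Rintegral_probability_cst (p s) (p1 s)).
  apply: (Rintegral_le _ (p1 s)) => // [|t].
    exact: bounded_measurable_cst.
  by have := fM t; rewrite ler_norml => /andP[].
(* Adding M makes the integrand nonnegative, as [measurable_fun_integral_kernel] requires; since
   [p s] has mass one, the shift is subtracted afterwards. *)
have -> : (fun s => Rintegral (p s) [set: X] f) =
    (fun s => fine (\int[p s]_t (f t + M)%:E) - M).
  apply/funext => s.
  rewrite -[RHS]/(Rintegral (p s) [set: X] (fun t => f t + M) - M).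
  rewrite (Rintegral_add _ (p1 s))//; last exact: bounded_measurable_cst.
  by rewrite (Rintegral_probability_cst _ (p1 s)) addrK.
apply: measurable_funB => //; apply: measurableT_comp => //.
apply: measurable_fun_integral_kernel => //.
- by move=> U mU; exact: measurable_kernel.
- by move=> t; rewrite lee_fin; have := fM t; rewrite ler_norml => /andP[]; lra.
- by apply/measurable_EFinP; exact: measurable_funD.
Qed.

(** Stationarity says that [mu] agrees on measurable sets with the composition of the constant
    kernel [mu] with [p]; integrating against a composition is an iterated integral. *)
Lemma integral_stationary (mu : probability X R) (f : X -> \bar R) :
  stationary p mu -> (forall s, 0 <= f s)%E -> measurable_fun [set: X] f ->
  (\int[mu]_s f s = \int[mu]_s \int[p s]_t f t)%E.
Proof.
move=> mu_p f0 mf.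
pose l : R.-pker X ~> X :=
  kprobability (measurable_cst (mu : pprobability X R)).
rewrite (eq_measure_integral (kcomp l (kernel.kernel_snd p) point)); last first.
  by move=> Z mZ _; exact: mu_p.
by rewrite integral_kcomp.
Qed.

End kernel_average.

(** * The temporal-difference matrix *)

Lemma dotmx_outer {R : comPzRingType} {m n : nat} (y x : 'cV[R]_m)
    (z v : 'cV[R]_n) :
  dotmx y (x *m z^T *m v) = dotmx y x * dotmx z v.
Proof.
have -> : dotmx y (x *m z^T *m v) = ((y^T *m x) *m (z^T *m v)) 0 0.
  by rewrite /dotmx !mulmxA.
by rewrite mxE big_ord1.
Qed.

Lemma measurable_borel_continuous {R : realType} {T : ptopologicalType}
    (f : T -> R) :
  continuous f -> measurable_fun [set: borel T] f.
Proof.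
move=> /continuousP cf; apply: (measurability _ (RGenOpens.measurableE R)).
move=> _ [_ [a [b ->] <-]]; rewrite setTI.
by apply: sub_sigma_algebra; exact/cf/interval_open.
Qed.

Lemma ereal_sup_bounded {R : realType} {T : Type} (f : T -> R) :
  (ereal_sup [set (f s)%:E | s in setT] < +oo)%E ->
  exists M : R, forall s, f s <= M.
Proof.
move=> fy; have fS s := @ereal_sup_ubound _ [set (f s)%:E | s in setT] (f s)%:E
  (ex_intro2 _ _ s Logic.I erefl).
move: fy fS; case: ereal_sup => [M _ fM| // |_ fN].
  by exists M => s; rewrite -lee_fin.
(* A supremum of -oo leaves no point s, so any bound works. *)
by exists 0 => s; have := fN s; rewrite leeNy_eq.
Qed.

Section temporal_difference.
Context {dX : measure_display} {X : measurableType dX} {R : realType} {d : nat}.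
Variables (p : R.-pker X ~> X) (mu : probability X R) (gamma : R).
Variables (r : X -> R) (x : X -> 'cV[R]_d).
Hypothesis mu_stationary : stationary p mu.
Hypothesis gamma_range : 0 <= gamma < 1.
Hypothesis r_bounded : bounded_measurable r.
Hypothesis x_bounded : forall i, bounded_measurable (fun s => x s i 0).

Let mu1 : mu [set: X] = 1%E. Proof. exact: probability_setT. Qed.

Let p1 s : p s [set: X] = 1%E. Proof. exact: prob_kernel. Qed.

Let xy_bounded (y : 'cV[R]_d) : bounded_measurable (fun s => dotmx y (x s)).
Proof. exact: bounded_measurable_dotmx. Qed.

(** The semidefinite form C for the dissipativity argument; it is singular when the features are
    linearly dependent in L^2(mu). *)
Definition feature_gram : 'M[R]_d := mxintegral mu (fun s => x s *m (x s)^T).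

Lemma feature_gram_sym : feature_gram^T = feature_gram.
Proof.
apply/matrixP => i j; rewrite !mxE; congr (Rintegral _ _ _); apply/funext => s.
by rewrite !mxE !big_ord1 !mxE mulrC.
Qed.

Lemma dotmx_feature_gram (y : 'cV[R]_d) : dotmx y (feature_gram *m y) =
  Rintegral mu [set: X] (fun s => dotmx y (x s) * dotmx y (x s)).
Proof.
rewrite (dotmx_mxintegral _ mu1) => [|i j]; last first.
  under eq_fun do rewrite mxE big_ord1 mxE.
  exact: bounded_measurableM.
congr (Rintegral _ _ _); apply/funext => s.
by rewrite dotmx_outer [dotmx (x s) y]dotmxC.
Qed.

Lemma feature_gram_psd (y : 'cV[R]_d) : 0 <= dotmx y (feature_gram *m y).
Proof.
rewrite dotmx_feature_gram; apply: Rintegral_ge0 => s _.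
by rewrite -expr2 sqr_ge0.
Qed.

Lemma dotmx_markov_op (v : 'cV[R]_d) (s : X) : dotmx v (markov_op p x s) =
  Rintegral (p s) [set: X] (fun t => dotmx v (x t)).
Proof.
rewrite -[markov_op p x s]mulmx1 (dotmx_mxintegral _ (p1 s)) => [|i j].
  by congr (Rintegral _ _ _); apply/funext => t; rewrite mulmx1.
by rewrite (ord1 j).
Qed.

Lemma dotmx_td_matrix (y v : 'cV[R]_d) :
  dotmx y (td_matrix p mu gamma x *m v) =
  Rintegral mu [set: X] (fun s => dotmx y (x s) *
    (gamma * Rintegral (p s) [set: X] (fun t => dotmx v (x t)) -
     dotmx v (x s))).
Proof.
rewrite (dotmx_mxintegral _ mu1) => [|i j]; last first.
  under eq_fun do rewrite mxE big_ord1 !mxE.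
  apply: bounded_measurableM => //; apply: bounded_measurableB => //.
  by apply: bounded_measurableZ; exact: bounded_measurable_average.
congr (Rintegral _ _ _); apply/funext => s.
rewrite -linearZ -linearB dotmx_outer -scaleN1r dotmxDl !dotmxZl.
by rewrite ![dotmx _ v]dotmxC dotmx_markov_op mulN1r.
Qed.

Lemma dotmx_td_vector (y : 'cV[R]_d) : dotmx y (td_vector mu r x) =
  Rintegral mu [set: X] (fun s => dotmx y (x s) * r s).
Proof.
rewrite -[td_vector mu r x]mulmx1.
rewrite (dotmx_mxintegral _ mu1) => [|i j]; last first.
  by rewrite (ord1 j); under eq_fun do rewrite mxE; exact: bounded_measurableM.
congr (Rintegral _ _ _); apply/funext => s.
by rewrite mulmx1 dotmxZr mulrC.
Qed.

Lemma td_matrix_dissipative (y : 'cV[R]_d) :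
  dotmx y (td_matrix p mu gamma x *m y) <=
  - (1 - gamma) * dotmx y (feature_gram *m y).
Proof.
have /andP[g0 g1] := gamma_range.
rewrite dotmx_td_matrix dotmx_feature_gram; set f := fun s => dotmx y (x s).
pose Pf s := Rintegral (p s) [set: X] f.
pose Pff s := Rintegral (p s) [set: X] (fun t => f t * f t).
rewrite -/Pf.
have bf : bounded_measurable f by exact: xy_bounded.
have bff : bounded_measurable (fun s => f s * f s).
  exact: bounded_measurableM.
have bPf : bounded_measurable Pf by exact: bounded_measurable_average.
have bPff : bounded_measurable Pff by exact: bounded_measurable_average.
have Pff_f :
    Rintegral mu [set: X] Pff = Rintegral mu [set: X] (fun s => f s * f s).
  rewrite /Rintegral; congr fine.
  rewrite [RHS](integral_stationary p)//; last 2 first.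
  - by move=> s; rewrite lee_fin -expr2 sqr_ge0.
  - by apply/measurable_EFinP; have [] := bff.
  apply: eq_integral => s _; rewrite fineK//.
  apply: integrable_fin_num => //.
  exact: (bounded_measurable_integrable _ (p1 s)).
(* Pointwise, 2 f Pf <= f^2 + (Pf)^2 and Jensen's (Pf)^2 <= P(f^2) bound the integrand. After
   integration, stationarity equates the integrals of P(f^2) and f^2, and the coefficients add up to
   gamma - 1. *)
apply: (@le_trans _ _ (Rintegral mu [set: X]
    (fun s => gamma / 2 * Pff s + (gamma / 2 - 1) * (f s * f s)))).
  apply: (Rintegral_le _ mu1) => [||s].
  - apply: bounded_measurableM => //; apply: bounded_measurableB => //.
    exact: bounded_measurableZ.
  - by apply: bounded_measurableD; exact: bounded_measurableZ.
  - rewrite -/(f s).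
    have := sqr_Rintegral_le _ (p1 s) _ bf; rewrite -/(Pf s) -/(Pff s).
    have := sqr_ge0 (f s - Pf s); move: (f s) (Pf s) (Pff s) => a b c.
    move=> ab bc; have : 0 <= gamma * (c + a * a - 2 * (a * b)).
      by apply: mulr_ge0 => //; lra.
    lra.
rewrite (Rintegral_add _ mu1); [|exact: bounded_measurableZ..].
by rewrite !(RintegralZ _ mu1)// Pff_f; lra.
Qed.

(** Both y'A v and y'b are integrals of products with the factor y'x, which is null in L^2(mu). *)
Lemma td_null (y : 'cV[R]_d) : dotmx y (feature_gram *m y) = 0 ->
  (td_matrix p mu gamma x)^T *m y = 0 /\ dotmx y (td_vector mu r x) = 0.
Proof.
rewrite dotmx_feature_gram => y0; split.
  apply: dotmx_eq0P => v; rewrite dotmx_mulr trmxK dotmxC dotmx_td_matrix.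
  apply: (Rintegral_mul_eq0 _ mu1) => //; apply: bounded_measurableB => //.
  by apply: bounded_measurableZ; exact: bounded_measurable_average.
by rewrite dotmx_td_vector; exact: (Rintegral_mul_eq0 _ mu1).
Qed.

End temporal_difference.

Theorem theorem8 (R : realType) (K d : nat)
  (S : set 'cV[R]_K) (S0 : S !=set0)
  (p : R.-pker (borel_subset S0) ~> (borel_subset S0))
  (r : borel_subset S0 -> R)
  (gamma : R)
  (x : borel_subset S0 -> 'cV[R]_d)
  (mu : probability (borel_subset S0) R)
  (r_measurable : measurable_fun [set: borel_subset S0] r)
  (gamma_range : 0 <= gamma < 1)
  (x_measurable : borel_measurable (x : subset_type S0 -> 'cV[R]_d))
  (mu_stationary : unique_stationary p mu)
  (mu_open : forall U : set (subset_type S0),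
     open U -> U !=set0 -> (0 < mu U)%E)
  (x_bounded : (ereal_sup [set (`|x s|)%:E | s in setT] < +oo)%E)
  (r_bounded : (ereal_sup [set (`|r s|)%:E | s in setT] < +oo)%E)
  (P_null : forall (n : nat) (f : borel_subset S0 -> 'cV[R]_n),
     borel_measurable (f : subset_type S0 -> 'cV[R]_n) ->
     {ae mu, forall s, f s = 0} -> {ae mu, forall s, markov_op p f s = 0}) :
  forall w0 : 'cV[R]_d, exists winf : 'cV[R]_d,
    td_fixed_points p mu gamma r x winf /\
    forall w : R -> 'cV[R]_d,
      affine_ode_solution (td_matrix p mu gamma x) (td_vector mu r x) w0 w ->
      w t @[t --> +oo] --> winf.
Proof.
move=> w0; have [mu_p _] := mu_stationary.
have br : bounded_measurable r.
  by split=> //; have [M rM] := ereal_sup_bounded _ r_bounded; exists M.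
have bx i : bounded_measurable (fun s => x s i 0).
  split.
    have mi := @measurable_borel_continuous R 'cV[R]_d (fun M => M i 0)
      (@coord_continuous _ _ _ i 0).
    exact: (measurableT_comp mi
      (x_measurable : measurable_fun _ (x : _ -> borel _))).
  (* The norm on column vectors is the max norm, so it dominates each coordinate. *)
  have [M xM] := ereal_sup_bounded _ x_bounded; exists M => s.
  apply: le_trans (xM s); rewrite [leRHS]/Num.Def.normr/= mx_normrE.
  exact: (le_bigmax _ _ (i, 0)).
have g1 : 0 < 1 - gamma by rewrite subr_gt0; have /andP[] := gamma_range.
have [winf Aw winfP] := affine_ode_cvg _ _ _ _ g1 (feature_gram_sym mu x)
  (feature_gram_psd mu x bx)
  (td_matrix_dissipative p mu gamma x mu_p gamma_range bx)
  (td_null p mu gamma r x br bx) w0.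
by exists winf.
Qed.
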